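(* There exists a simple closed smooth curve $\gamma$ in $\mathbb{D}^*=\{z\in\mathbb{C}:0<|z|<1\}$, bounding a domain $V\subset\mathbb{D}=\{z\in\mathbb{C}:|z|<1\}$ which includes $0$, such that: (i) $\oint_{\gamma}\kappa_g\,d(\mathrm{length})>2\pi$, where $\kappa_g$ and length are taken with respect to the complete hyperbolic metric on $\mathbb{D}^*$; (ii) the maximum on $\gamma$ of the function $\lambda_{\mathbb{D}^*}(z)=-\frac{1}{|z|\log|z|}$ is attained at a point $z_{\max}\in\gamma$ at which the normal derivative satisfies $\frac{\partial\lambda_{\mathbb{D}^*}}{\partial\vec{n}}(z_{\max})<0$.
   Context: The complete hyperbolic metric on $\mathbb{D}^*$ is $ds^2_{\mathbb{D}^*}=\lambda_{\mathbb{D}^*}^2\,|dz|^2$ with $\lambda_{\mathbb{D}^*}(z)=-\frac{1}{|z|\log|z|}$. The geodesic curvature $\kappa_g$ of a curve bounding a domain $V$ containing $0$ is signed so that it is positive when the curve bends towards $V$ (for example the circles $|z|=r$, which are horocycles, have $\kappa_g=1$). The vector $\vec{n}$ is the normal to $\gamma$ pointing out of $V$. *)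

(* Defs.v *)
From Stdlib Require Import Reals.
From Coquelicot Require Import Coquelicot.
Open Scope R_scope.

Definition connected (V : C -> Prop) : Prop :=
  forall A B : C -> Prop, open A -> open B ->
    (forall z, V z -> A z \/ B z) ->
    (exists z, V z /\ A z) -> (exists z, V z /\ B z) ->
    exists z, V z /\ A z /\ B z.

Definition plane_domain (V : C -> Prop) : Prop :=
  open V /\ (exists z, V z) /\ connected V.

Definition boundary (V : C -> Prop) (z : C) : Prop :=
  forall U : C -> Prop, open U -> U z ->
    (exists w, U w /\ V w) /\ (exists w, U w /\ ~ V w).

Definition unit_disk (z : C) : Prop := Cmod z < 1.

Definition punctured_disk (z : C) : Prop := 0 < Cmod z < 1.

(** The two real coordinates are indexed by [bool]: [false] for the real part,
    [true] for the imaginary part. *)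
Definition coord (k : bool) (z : C) : R := if k then Im z else Re z.

Definition basis (k : bool) : C := if k then Ci else RtoC 1.

Definition sum2 (f : bool -> R) : R := f false + f true.

Definition dirderiv (f : C -> R) (z v : C) : R :=
  Derive (fun s : R => f (z + RtoC s * v)%C) 0.

Definition partial (k : bool) (f : C -> R) (z : C) : R := dirderiv f z (basis k).

Definition velocity (gamma : R -> C) (t : R) : C :=
  (Derive (fun s => Re (gamma s)) t, Derive (fun s => Im (gamma s)) t).

(** A closed curve is a [T]-periodic parametrization; smooth means C^infinity
    and regular. *)
Definition simple_closed_smooth_curve (gamma : R -> C) (T : R) : Prop :=
  0 < T /\
  (forall (k : bool) (m : nat) (t : R), ex_derive_n (fun s => coord k (gamma s)) m t) /\
  (forall t, velocity gamma t <> RtoC 0) /\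
  (forall t, gamma (t + T) = gamma t) /\
  (forall s t, 0 <= s < T -> 0 <= t < T -> gamma s = gamma t -> s = t).

(** [g i j z] is the coefficient g_ij at the point [z]. *)
Definition metric := bool -> bool -> C -> R.

Definition conformal_metric (lambda : C -> R) : metric :=
  fun i j z => if Bool.eqb i j then lambda z ^ 2 else 0.

Definition inner (g : metric) (p v w : C) : R :=
  sum2 (fun i => sum2 (fun j => g i j p * coord i v * coord j w)).

Definition gnorm (g : metric) (p v : C) : R := sqrt (inner g p v v).

Definition gdet (g : metric) (z : C) : R :=
  g false false z * g true true z - g false true z * g true false z.

(** Entries g^ij of the inverse of the 2 x 2 matrix (g_ij). *)
Definition ginv (g : metric) : metric := fun i j z =>
  (if Bool.eqb i j then g (negb i) (negb i) z else - g i j z) / gdet g z.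

(** The symbol Gamma^k_ij of the Levi-Civita connection. *)
Definition christoffel (g : metric) (k i j : bool) (z : C) : R :=
  / 2 * sum2 (fun l =>
    ginv g k l z * (partial i (g j l) z + partial j (g i l) z - partial l (g i j) z)).

Definition covariant_acceleration (g : metric) (gamma : R -> C) (t : R) : C :=
  let acc k :=
    Derive_n (fun s => coord k (gamma s)) 2 t +
    sum2 (fun i => sum2 (fun j =>
      christoffel g k i j (gamma t) *
      coord i (velocity gamma t) * coord j (velocity gamma t))) in
  (acc false, acc true).

Definition speed (g : metric) (gamma : R -> C) (t : R) : R :=
  gnorm g (gamma t) (velocity gamma t).

(** [n] is a nonzero [g]-normal to [gamma] at time [t] pointing out of [V]. *)
Definition outward_normal (g : metric) (V : C -> Prop) (gamma : R -> C) (t : R) (n : C)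
    : Prop :=
  n <> RtoC 0 /\
  inner g (gamma t) (velocity gamma t) n = 0 /\
  exists delta : R, 0 < delta /\
    forall s : R, 0 < s < delta ->
      ~ V (gamma t + RtoC s * n)%C /\ V (gamma t - RtoC s * n)%C.

(** Geodesic curvature of [gamma] with respect to the outward normal field [n],
    positive when [gamma] bends towards the side opposite to [n]. The field [n]
    need not be normalized, hence the division by its [g]-norm. *)
Definition geodesic_curvature (g : metric) (gamma n : R -> C) (t : R) : R :=
  - inner g (gamma t) (covariant_acceleration g gamma t) (n t) /
    (gnorm g (gamma t) (n t) * speed g gamma t ^ 2).

Definition lambda_pdisk (z : C) : R := - (1 / (Cmod z * ln (Cmod z))).

Definition hyp_pdisk : metric := conformal_metric lambda_pdisk.

(* Main.v *)
Require Import Defs.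
From Stdlib Require Import Reals Lra Psatz.
From Coquelicot Require Import Coquelicot.
Open Scope R_scope.

(** The curve is given in polar form by [|z| = exp (- L t)], where [t] is the
    angle and [L > 0] is [2 PI]-periodic.  For such a curve
      [curvature * speed = 1 / L + L'' / (1 + L' ^ 2)]
    ([polar_curve_curvature_form]).  The second term is the derivative of
    [atan L'] and integrates to 0 over a period, so the total curvature is the
    integral of [1 / L].  (By Gauss-Bonnet this is the hyperbolic area of [V]
    minus the cusp.)

    On the circle [|z| = r] the function lambda is [exp L / L] with [L = - ln r];
    it has its minimum at [L = 1], where the total curvature is exactly [2 PI].
    So let [L] oscillate around 1.  With [1 / L = w = 11/10 - 9/10 * cos t] the
    mean of [1 / L] is [11/10 > 1], and [w] runs through the interval
    [[1/5, 2]].  As [w * exp (1 / w)] is smaller at [2] than at [1/5], lambda is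
    largest on the curve at the point [t = 0] nearest to the puncture
    ([lambda_ovoid_max]).  There the outward normal is radial, and lambda
    decreases along it because [L = 5 > 1].

    The domain [V] consists of 0 and of the points where
    [gauge z = ln |z| + 1 / w] is negative.  It is open and star-shaped, and the
    gauge vanishes exactly on the curve and increases along the normal, which
    gives the boundary and the direction of the normal. *)

(** * Functions with derivatives of all orders *)

(** A family of functions that contains the derivative of each of its members:
    this closure alone makes every member infinitely differentiable, without
    formulas for iterated derivatives of products and composites. *)
Inductive elementary : (R -> R) -> Prop :=
  | elementary_const c : elementary (fun _ => c)
  | elementary_cos : elementary cos
  | elementary_sin : elementary sin
  | elementary_plus f g : elementary f -> elementary g -> elementary (fun t => f t + g t)
  | elementary_opp f : elementary f -> elementary (fun t => - f t)
  | elementary_mult f g : elementary f -> elementary g -> elementary (fun t => f t * g t)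
  | elementary_inv f : elementary f -> (forall t, f t <> 0) -> elementary (fun t => / f t)
  | elementary_exp f : elementary f -> elementary (fun t => exp (f t)).

Lemma elementary_is_derive f :
  elementary f -> exists g, elementary g /\ forall t, is_derive f t (g t).
Proof.
induction 1 as [c| | |f g _ [f' [Ef Df]] _ [g' [Eg Dg]]
               |f _ [f' [Ef Df]]|f g ? [f' [Ef Df]] ? [g' [Eg Dg]]|f ? [f' [Ef Df]] Hf|f ? [f' [Ef Df]]].
- exists (fun _ => 0); split; [constructor | intros t; auto_derive; trivial].
- exists (fun t => - sin t); split; [repeat constructor |].
  intros t; auto_derive; [trivial | ring].
- exists cos; split; [constructor | intros t; auto_derive; [trivial | ring]].
- exists (fun t => f' t + g' t); split; [now constructor |].
  intros t; exact (is_derive_plus _ _ _ _ _ (Df t) (Dg t)).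
- exists (fun t => - f' t); split; [now constructor |].
  intros t; exact (is_derive_opp _ _ _ (Df t)).
- exists (fun t => f' t * g t + f t * g' t); split; [repeat constructor; trivial |].
  intros t; apply (is_derive_mult f g); auto; intros; apply Rmult_comm.
- exists (fun t => - (f' t * (/ f t * / f t))); split; [repeat constructor; trivial |].
  intros t; evar_last; [exact (is_derive_inv _ _ _ (Df t) (Hf t)) | field; apply Hf].
- exists (fun t => f' t * exp (f t)); split; [repeat constructor; trivial |].
  intros t; exact (is_derive_comp exp f t _ _ (is_derive_exp _) (Df t)).
Qed.

Lemma elementary_Derive_n f m :
  elementary f -> exists g, elementary g /\ forall t, Derive_n f m t = g t.
Proof.
intros Ef; induction m as [|m [g [Eg Hg]]]; [now exists f |].
destruct (elementary_is_derive g Eg) as [g' [Eg' Hg']].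
exists g'; split; [trivial | intros t; simpl].
rewrite (Derive_ext _ g); [now apply is_derive_unique | exact Hg].
Qed.

Lemma elementary_ex_derive_n f m t : elementary f -> ex_derive_n f m t.
Proof.
intros Ef; destruct m as [|m]; simpl; [trivial |].
destruct (elementary_Derive_n f m Ef) as [g [Eg Hg]].
destruct (elementary_is_derive g Eg) as [g' [_ Hg']].
apply ex_derive_ext with g; [now intros; rewrite Hg | exists (g' t); apply Hg'].
Qed.

(** * Curvature in a conformal metric *)

Lemma conformal_inner (lam : C -> R) (p v w : C) :
  inner (conformal_metric lam) p v w = lam p ^ 2 * (Re v * Re w + Im v * Im w).
Proof. unfold inner, sum2, conformal_metric; simpl; ring. Qed.

Lemma conformal_gnorm (lam : C -> R) (p v : C) :
  0 <= lam p -> gnorm (conformal_metric lam) p v = lam p * Cmod v.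
Proof.
intros Hl; unfold gnorm; rewrite conformal_inner, sqrt_mult_alt by nra.
rewrite sqrt_pow2 by trivial; unfold Cmod, Re, Im; do 2 f_equal; ring.
Qed.

(** Here [dphi] is the Euclidean gradient of [ln lam]: only the logarithmic
    derivative of the conformal factor enters the connection. *)
Lemma conformal_christoffel (lam : C -> R) (z dphi : C) :
  lam z <> 0 ->
  (forall k, is_derive (fun s => lam (z + RtoC s * basis k)%C) 0 (lam z * coord k dphi)) ->
  forall k i j, christoffel (conformal_metric lam) k i j z =
    (if Bool.eqb k j then coord i dphi else 0) + (if Bool.eqb k i then coord j dphi else 0)
    - (if Bool.eqb i j then coord k dphi else 0).
Proof.
intros Hl Hd.
assert (Hz : forall k, lam (z + RtoC 0 * basis k)%C = lam z)
  by (intros k; f_equal; ring).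
assert (Hp : forall l i j, partial l (conformal_metric lam i j) z =
    if Bool.eqb i j then 2 * lam z ^ 2 * coord l dphi else 0).
{ intros l i j; unfold partial, dirderiv, conformal_metric.
  destruct (Bool.eqb i j); [| apply Derive_const].
  apply is_derive_unique.
  apply (is_derive_ext (fun s => lam (z + RtoC s * basis l)%C * lam (z + RtoC s * basis l)%C));
    [intros; simpl; now rewrite Rmult_1_r |].
  evar_last.
  - apply (is_derive_mult (fun s => lam (z + RtoC s * basis l)%C)
             (fun s => lam (z + RtoC s * basis l)%C)); try apply Hd; intros; apply Rmult_comm.
  - simpl; rewrite Hz; unfold mult, plus; simpl; ring. }
intros k i j; unfold christoffel, sum2; rewrite !Hp.
unfold ginv, gdet, conformal_metric.
destruct k, i, j; simpl; field; trivial.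
Qed.

(** The rotation by [-PI/2] of the unit tangent. *)
Definition right_normal (gamma : R -> C) (t : R) : C :=
  let v := velocity gamma t in (Im v / Cmod v, - Re v / Cmod v).

Lemma Cmod_sqr (z : C) : Cmod z ^ 2 = Re z ^ 2 + Im z ^ 2.
Proof. unfold Cmod; rewrite pow2_sqrt; [reflexivity | nra]. Qed.

Lemma Cmod_right_normal (gamma : R -> C) (t : R) :
  velocity gamma t <> RtoC 0 -> Cmod (right_normal gamma t) = 1.
Proof.
intros Hv; unfold right_normal; cbv zeta.
set (v := velocity gamma t) in *.
assert (Hm : 0 < Cmod v) by now apply Cmod_gt_0.
assert (Hm2 := Cmod_sqr v).
unfold Cmod at 1; cbn [fst snd]; rewrite <- sqrt_1; f_equal.
transitivity ((Re v ^ 2 + Im v ^ 2) / Cmod v ^ 2); [field; lra |].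
rewrite <- Hm2; field; lra.
Qed.

(** The change of geodesic curvature under a conformal change of metric: the
    first summand is the Euclidean curvature form, the derivative of the angle of
    the tangent, and the second is the normal derivative of [ln lam] times the
    Euclidean speed.  The tangential part of the connection term is killed by the
    product with the normal. *)
Lemma conformal_curvature_form (lam : C -> R) (gamma : R -> C) (t : R) (dphi : C) :
  0 < lam (gamma t) ->
  (forall k, is_derive (fun s => lam (gamma t + RtoC s * basis k)%C) 0
               (lam (gamma t) * coord k dphi)) ->
  velocity gamma t <> RtoC 0 ->
  let g := conformal_metric lam in
  let v := velocity gamma t in
  geodesic_curvature g gamma (right_normal gamma) t * speed g gamma t =
  (Re v * Derive_n (fun s => Im (gamma s)) 2 t - Im v * Derive_n (fun s => Re (gamma s)) 2 t)
    / (Re v ^ 2 + Im v ^ 2)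
  + (Re dphi * Im v - Im dphi * Re v).
Proof.
intros Hl Hd Hv g v.
assert (Hm : 0 < Cmod v) by now apply Cmod_gt_0.
assert (Hm2 := Cmod_sqr v).
assert (Hn := Cmod_right_normal gamma t Hv).
unfold geodesic_curvature, speed, g; rewrite !conformal_gnorm by lra.
rewrite conformal_inner, Hn; fold v.
unfold covariant_acceleration, sum2.
rewrite !(conformal_christoffel lam (gamma t) dphi) by (trivial; lra).
rewrite <- Hm2; unfold right_normal; fold v.
cbn [Bool.eqb coord Re Im fst snd].
fold (Re v) (Im v) (Re dphi) (Im dphi).
set (x2 := Derive_n _ 2 t); set (y2 := Derive_n _ 2 t).
(* [field] does not know that [Cmod v ^ 2] is the sum of squares. *)
transitivity ((Re v * y2 - Im v * x2) / Cmod v ^ 2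
  + (Re dphi * Im v - Im dphi * Re v) * ((Re v ^ 2 + Im v ^ 2) / Cmod v ^ 2)).
- field; lra.
- rewrite <- Hm2; field; lra.
Qed.

(** * The metric of the punctured disk along polar curves *)

Lemma Cmod_is_derive (z v : C) :
  z <> RtoC 0 ->
  is_derive (fun s : R => Cmod (z + RtoC s * v)%C) 0 ((Re z * Re v + Im z * Im v) / Cmod z).
Proof.
intros Hz; apply Cmod_gt_0 in Hz.
assert (Hq : 0 < Re z ^ 2 + Im z ^ 2) by (rewrite <- Cmod_sqr; now apply pow_lt).
apply (is_derive_ext (fun s => sqrt ((Re z + s * Re v) ^ 2 + (Im z + s * Im v) ^ 2))).
{ intros s; unfold Cmod; f_equal; simpl; unfold Re, Im; ring. }
auto_derive; rewrite !Rmult_0_l, !Rplus_0_r.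
- simpl in Hq; rewrite !Rmult_1_r in *; exact Hq.
- replace (Re z * (Re z * 1) + Im z * (Im z * 1)) with (Cmod z ^ 2) by (rewrite Cmod_sqr; ring).
  rewrite sqrt_pow2 by lra; field; lra.
Qed.

(** lambda is the function [- 1 / (r * ln r)] of [r = Cmod z], whose logarithmic
    derivative is [- (1 + / ln r) / r]. *)
Lemma lambda_pdisk_is_derive (z v : C) :
  punctured_disk z ->
  is_derive (fun s : R => lambda_pdisk (z + RtoC s * v)%C) 0
    (lambda_pdisk z * (- (1 + / ln (Cmod z)) / Cmod z ^ 2 * (Re z * Re v + Im z * Im v))).
Proof.
intros [Hz Hz1].
assert (Hl : ln (Cmod z) < 0) by (rewrite <- ln_1; now apply ln_increasing).
evar_last.
- apply (is_derive_comp (fun r => - (1 / (r * ln r)))); cycle 1.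
  + apply Cmod_is_derive; intros ->; rewrite Cmod_0 in Hz; lra.
  + replace (z + RtoC 0 * v)%C with z by ring.
    auto_derive; [repeat split; trivial; nra | reflexivity].
- unfold lambda_pdisk, scal; simpl; unfold mult; simpl; field; lra.
Qed.

Definition polar_curve (L : R -> R) (t : R) : C :=
  (exp (- L t) * cos t, exp (- L t) * sin t).

Lemma cos_sin_sqr t : cos t ^ 2 + sin t ^ 2 = 1.
Proof. rewrite <- !Rsqr_pow2, Rplus_comm; apply sin2_cos2. Qed.

Lemma Cmod_polar_curve L t : Cmod (polar_curve L t) = exp (- L t).
Proof.
unfold Cmod, polar_curve; cbn [fst snd].
replace (_ + _) with (exp (- L t) ^ 2 * (cos t ^ 2 + sin t ^ 2)) by ring.
rewrite cos_sin_sqr, Rmult_1_r; apply sqrt_pow2, Rlt_le, exp_pos.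
Qed.

Lemma polar_curve_punctured_disk L t : 0 < L t -> punctured_disk (polar_curve L t).
Proof.
intros HL; unfold punctured_disk; rewrite Cmod_polar_curve; split; [apply exp_pos |].
rewrite <- exp_0; apply exp_increasing; lra.
Qed.

Lemma lambda_polar_curve L t : 0 < L t -> lambda_pdisk (polar_curve L t) = exp (L t) / L t.
Proof.
intros HL; unfold lambda_pdisk; rewrite Cmod_polar_curve, ln_exp, exp_Ropp.
field; split; [lra | apply Rgt_not_eq, exp_pos].
Qed.

Section PolarCurve.

Variables L L1 L2 : R -> R.
Hypothesis L_is_derive : forall t, is_derive L t (L1 t).
Hypothesis L1_is_derive : forall t, is_derive L1 t (L2 t).

Let ex_derive_L t : ex_derive L t.
Proof. exists (L1 t); apply L_is_derive. Qed.
Let ex_derive_L1 t : ex_derive L1 t.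
Proof. exists (L2 t); apply L1_is_derive. Qed.
Let Derive_L t : Derive (fun x => L x) t = L1 t.
Proof. apply is_derive_unique, L_is_derive. Qed.
Let Derive_L1 t : Derive (fun x => L1 x) t = L2 t.
Proof. apply is_derive_unique, L1_is_derive. Qed.

Lemma velocity_polar_curve t :
  velocity (polar_curve L) t =
  (exp (- L t) * (- L1 t * cos t - sin t), exp (- L t) * (- L1 t * sin t + cos t)).
Proof.
unfold velocity, polar_curve; simpl; f_equal; apply is_derive_unique; auto_derive; trivial;
  rewrite Derive_L; ring.
Qed.

Lemma Cmod_velocity_polar_curve_sqr t :
  Re (velocity (polar_curve L) t) ^ 2 + Im (velocity (polar_curve L) t) ^ 2 =
  exp (- L t) ^ 2 * (1 + L1 t ^ 2).
Proof.
rewrite velocity_polar_curve; simpl Re; simpl Im.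
transitivity (exp (- L t) ^ 2 * (1 + L1 t ^ 2) * (cos t ^ 2 + sin t ^ 2));
  [ring | rewrite cos_sin_sqr; ring].
Qed.

Lemma velocity_polar_curve_neq_0 t : velocity (polar_curve L) t <> RtoC 0.
Proof.
intros H; assert (Hq := Cmod_velocity_polar_curve_sqr t); rewrite H in Hq; simpl in Hq.
assert (He := exp_pos (- L t)).
assert (0 < exp (- L t) * exp (- L t)) by now apply Rmult_lt_0_compat.
nra.
Qed.

Lemma polar_curve_Derive_2 t :
  Derive_n (fun s => Re (polar_curve L s)) 2 t =
    exp (- L t) * ((L1 t ^ 2 - L2 t - 1) * cos t + 2 * L1 t * sin t) /\
  Derive_n (fun s => Im (polar_curve L s)) 2 t =
    exp (- L t) * ((L1 t ^ 2 - L2 t - 1) * sin t - 2 * L1 t * cos t).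
Proof.
split; simpl.
- rewrite (Derive_ext _ (fun s => exp (- L s) * (- L1 s * cos s - sin s)))
    by (intros s; exact (f_equal fst (velocity_polar_curve s))).
  apply is_derive_unique; auto_derive; [auto | rewrite Derive_L, Derive_L1; ring].
- rewrite (Derive_ext _ (fun s => exp (- L s) * (- L1 s * sin s + cos s)))
    by (intros s; exact (f_equal snd (velocity_polar_curve s))).
  apply is_derive_unique; auto_derive; [auto | rewrite Derive_L, Derive_L1; ring].
Qed.

(** The tangent has angle [t + PI / 2 + atan (L1 t)], so the Euclidean part is
    [1 + L2 t / (1 + L1 t ^ 2)].  As [ln lambda] is radial, its part is
    [/ L t - 1], whatever [L1] is; the two constants cancel. *)
Lemma polar_curve_curvature_form t :
  0 < L t ->
  geodesic_curvature hyp_pdisk (polar_curve L) (right_normal (polar_curve L)) t *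
    speed hyp_pdisk (polar_curve L) t = / L t + L2 t / (1 + L1 t ^ 2).
Proof.
intros HL; unfold hyp_pdisk.
assert (He := exp_pos (- L t)).
(* [c * z] is the gradient of [ln lambda] at [z = polar_curve L t]. *)
set (c := - (1 + / - L t) / exp (- L t) ^ 2).
rewrite (conformal_curvature_form lambda_pdisk (polar_curve L) t
  (c * (exp (- L t) * cos t), c * (exp (- L t) * sin t))).
- destruct (polar_curve_Derive_2 t) as [-> ->].
  rewrite Cmod_velocity_polar_curve_sqr, velocity_polar_curve; cbn [Re Im fst snd].
  transitivity ((cos t ^ 2 + sin t ^ 2) * ((1 + L1 t ^ 2 + L2 t) / (1 + L1 t ^ 2)
    + c * exp (- L t) ^ 2)).
  + field; split; [nra | lra].
  + rewrite cos_sin_sqr; unfold c; field; repeat split; nra.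
- rewrite lambda_polar_curve by trivial; apply Rdiv_lt_0_compat; [apply exp_pos | trivial].
- intros k; evar_last.
  + apply lambda_pdisk_is_derive, polar_curve_punctured_disk; trivial.
  + rewrite Cmod_polar_curve, ln_exp; fold c; unfold polar_curve; destruct k; simpl; ring.
- apply velocity_polar_curve_neq_0.
Qed.

End PolarCurve.

(** * Star-shaped sets are connected *)

Lemma open_ray (P : C -> Prop) (z : C) (m : R) :
  open P -> P (RtoC m * z)%C ->
  exists d : posreal, forall s, Rabs (s - m) < d -> P (RtoC s * z)%C.
Proof.
intros oP HP.
assert (Hc : continuous (fun s : R => (RtoC s * z)%C) m).
{ apply (continuous_ext (fun s : R => (s * Re z, s * Im z) : C)).
  { intros s; unfold Cmult, RtoC, Re, Im; simpl; f_equal; ring. }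
  apply (continuous_comp_2 (fun s : R => s * Re z) (fun s => s * Im z)
           (fun x y : R => (x, y))).
  - apply (ex_derive_continuous (fun s : R => s * Re z)); auto_derive; trivial.
  - apply (ex_derive_continuous (fun s : R => s * Im z)); auto_derive; trivial.
  - intros Q HQ; apply filter_imp with (2 := HQ); now intros [x y]. }
destruct (Hc P (oP _ HP)) as [d Hd]; exists d; intros s Hs; apply Hd, Hs.
Qed.

(** Of two open sets covering [V], let [A] be one that contains 0, and let [z] be
    a point of [V] in the other set [B].  At the supremum of the [s <= 1] with
    [s * z] in [A], the point [s * z] lies in [A] or in [B]; in both cases
    openness gives a point of the segment that lies in [A] and [B]. *)
Lemma star_shaped_connected (V : C -> Prop) :
  V (RtoC 0) -> (forall z s, V z -> 0 <= s <= 1 -> V (RtoC s * z)%C) -> connected V.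
Proof.
intros V0 Vstar.
assert (Key : forall A B : C -> Prop, open A -> open B -> (forall z, V z -> A z \/ B z) ->
  A (RtoC 0) -> (exists z, V z /\ B z) -> exists z, V z /\ A z /\ B z).
{ intros A B oA oB cov A0 [z [Vz Bz]].
  set (E := fun s => 0 <= s <= 1 /\ A (RtoC s * z)%C).
  assert (E0 : E 0) by (split; [lra | replace (RtoC 0 * z)%C with (RtoC 0) by ring; trivial]).
  destruct (completeness E) as [m [ub lub]].
  { exists 1; intros s [? _]; lra. }
  { now exists 0. }
  assert (m0 : 0 <= m) by now apply ub.
  assert (m1 : m <= 1) by (apply lub; intros s [? _]; lra).
  assert (Vm : V (RtoC m * z)%C) by (apply Vstar; [trivial | lra]).
  destruct (cov _ Vm) as [Am | Bm].
  - destruct (open_ray A z m oA Am) as [d Hd].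
    assert (dpos := cond_pos d).
    destruct (Rlt_le_dec (m + d / 2) 1) as [Hm | Hm].
    + enough (m + d / 2 <= m) by lra.
      apply ub; split; [lra |]; apply Hd.
      rewrite Rabs_right; lra.
    + exists z; repeat split; trivial.
      replace z with (RtoC 1 * z)%C by ring; apply Hd.
      rewrite Rabs_right; lra.
  - destruct (open_ray B z m oB Bm) as [d Hd].
    assert (dpos := cond_pos d).
    destruct (Classical_Prop.classic (exists s, E s /\ m - d < s)) as [[s [Es Hs]] | Hno].
    + assert (s <= m) by now apply ub.
      destruct Es as [Hs01 As]; exists (RtoC s * z)%C; repeat split; trivial.
      * now apply Vstar.
      * apply Hd; rewrite Rabs_left1; lra.
    + enough (m <= m - d) by lra.
      apply lub; intros s Es; apply Rnot_lt_le; intros Hs; apply Hno; now exists s. }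
intros A B oA oB cov HA HB.
destruct (cov _ V0) as [A0 | B0].
- now apply Key.
- destruct (Key B A) as [z [? [? ?]]]; trivial.
  + intros z Vz; destruct (cov z Vz); auto.
  + now exists z.
Qed.

(** * The curve and the domain that it bounds *)

(** The reciprocal of [- ln |z|] on the curve, as a function of [u], the cosine of
    the angle.  Its mean over the circle, [11 / 10], exceeds 1; its range
    [[1/5, 2]] is so unbalanced around 1 that lambda is largest at the end
    [1/5]. *)
Definition weight (u : R) : R := 11 / 10 + - (9 / 10) * u.

(** The value of [- ln |z|] on the curve at the angle [t]. *)
Definition depth (t : R) : R := / weight (cos t).

(** Defined by the cosine [Re z / Cmod z] instead of the angle, which makes the
    gauge visibly continuous off 0. *)
Definition gauge (z : C) : R := ln (Cmod z) + / weight (Re z / Cmod z).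

Definition star_domain (z : C) : Prop := z = RtoC 0 \/ gauge z < 0.

Lemma weight_bounds u : -1 <= u <= 1 -> / 5 <= weight u <= 2.
Proof. unfold weight; lra. Qed.

Lemma inv_weight_bounds u : -1 <= u <= 1 -> / 2 <= / weight u <= 5.
Proof.
intros Hu; apply weight_bounds in Hu; split.
- apply Rinv_le_contravar; lra.
- rewrite <- (Rinv_inv 5); apply Rinv_le_contravar; lra.
Qed.

Lemma Re_div_Cmod_bounds z : -1 <= Re z / Cmod z <= 1.
Proof.
destruct (Ceq_dec z (RtoC 0)) as [-> | Hz].
- simpl; unfold Rdiv; rewrite Rmult_0_l; lra.
- apply Cmod_gt_0 in Hz.
  assert (H : Rabs (Re z / Cmod z) <= 1).
  { rewrite Rabs_div by lra; rewrite (Rabs_right (Cmod z)) by lra.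
    apply Rle_div_l; [lra |]; rewrite Rmult_1_l; apply re_le_Cmod. }
  now apply Rabs_le_between.
Qed.

(** The gauge is [ln |z|] plus a function of the direction alone. *)
Lemma gauge_scale s z : 0 < s -> z <> RtoC 0 -> gauge (RtoC s * z)%C = ln s + gauge z.
Proof.
intros Hs Hz; apply Cmod_gt_0 in Hz; unfold gauge.
rewrite Cmod_mult, Cmod_R, Rabs_right by lra.
rewrite ln_mult by trivial.
replace (Re (RtoC s * z) / (s * Cmod z)) with (Re z / Cmod z); [ring |].
simpl; unfold Re; field; lra.
Qed.

Lemma Cmod_continuous z : continuous Cmod z.
Proof. exact (filterlim_norm z). Qed.

Lemma gauge_continuous z : z <> RtoC 0 -> continuous gauge z.
Proof.
intros Hz; apply Cmod_gt_0 in Hz.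
assert (cRe : continuous Re z) by (destruct z; apply continuous_fst).
assert (cM := Cmod_continuous z).
apply (continuous_plus (fun w => ln (Cmod w)) (fun w => / weight (Re w / Cmod w))).
- apply (continuous_comp Cmod ln); [trivial |].
  apply (ex_derive_continuous ln); auto_derive; trivial.
- apply (continuous_comp (fun w => Re w / Cmod w) (fun u => / weight u)).
  + apply (continuous_mult Re (fun w => / Cmod w)); [trivial |].
    apply (continuous_comp Cmod Rinv); [trivial |].
    apply (ex_derive_continuous Rinv); auto_derive; lra.
  + apply (ex_derive_continuous (fun u => / weight u)); unfold weight; auto_derive.
    assert (H := weight_bounds _ (Re_div_Cmod_bounds z)); unfold weight in H; lra.
Qed.

Lemma small_disk_star_domain z : Cmod z < exp (- 5) -> star_domain z.
Proof.
intros Hz; destruct (Ceq_dec z (RtoC 0)) as [? | Hz0]; [now left | right].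
apply Cmod_gt_0 in Hz0; apply ln_increasing in Hz; [| trivial].
rewrite ln_exp in Hz; unfold gauge.
assert (H := inv_weight_bounds _ (Re_div_Cmod_bounds z)); lra.
Qed.

Lemma small_disk_open c : open (fun z => Cmod z < c).
Proof.
intros z Hz; apply (Cmod_continuous z (fun x => x < c)).
exact (open_lt c (Cmod z) Hz).
Qed.

Lemma star_domain_open : open star_domain.
Proof.
intros z; destruct (Ceq_dec z (RtoC 0)) as [-> | Hz]; intros HV.
- apply (filter_imp (fun w => Cmod w < exp (- 5))); [exact small_disk_star_domain |].
  apply small_disk_open; rewrite Cmod_0; apply exp_pos.
- destruct HV as [? | HV]; [easy |].
  apply (filter_imp (fun w => gauge w < 0)); [now right |].
  apply (gauge_continuous z Hz (fun x => x < 0)).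
  exact (open_lt 0 (gauge z) HV).
Qed.

Lemma star_domain_exterior_open : open (fun z => z <> RtoC 0 /\ 0 < gauge z).
Proof.
intros z [Hz HV]; apply filter_and.
- apply (filter_imp (fun w => 0 < Cmod w)).
  { intros w Hw ->; rewrite Cmod_0 in Hw; lra. }
  apply (Cmod_continuous z (fun x => 0 < x)).
  apply (open_gt 0 (Cmod z)); now apply Cmod_gt_0.
- apply (gauge_continuous z Hz (fun x => 0 < x)).
  exact (open_gt 0 (gauge z) HV).
Qed.

Lemma star_domain_scale z s : star_domain z -> 0 <= s <= 1 -> star_domain (RtoC s * z)%C.
Proof.
intros [-> | Hz] Hs; [left; ring |].
destruct (Req_dec s 0) as [-> | Hs0]; [left; ring |].
destruct (Ceq_dec z (RtoC 0)) as [-> | Hz0]; [left; ring |].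
right; rewrite gauge_scale by (trivial; lra).
assert (ln s <= 0) by (rewrite <- ln_1; apply ln_le; lra).
lra.
Qed.

Lemma star_domain_plane_domain : plane_domain star_domain.
Proof.
split; [exact star_domain_open | split; [exists (RtoC 0); now left |]].
apply star_shaped_connected; [now left | exact star_domain_scale].
Qed.

Lemma star_domain_unit_disk z : star_domain z -> unit_disk z.
Proof.
unfold unit_disk; intros [-> | Hz]; [rewrite Cmod_0; lra |].
destruct (Ceq_dec z (RtoC 0)) as [-> | Hz0]; [rewrite Cmod_0; lra |].
apply Cmod_gt_0 in Hz0; unfold gauge in Hz.
assert (H := inv_weight_bounds _ (Re_div_Cmod_bounds z)).
apply ln_lt_inv; [trivial | lra | rewrite ln_1; lra].
Qed.

Lemma polar_angle x y : x ^ 2 + y ^ 2 = 1 -> exists t, cos t = x /\ sin t = y.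
Proof.
intros H; assert (Hx : -1 <= x <= 1) by nra.
assert (Hs : sqrt (1 - Rsqr x) = Rabs y)
  by (rewrite <- sqrt_Rsqr_abs; f_equal; unfold Rsqr; lra).
destruct (Rle_dec 0 y) as [Hy | Hy].
- exists (acos x); rewrite cos_acos, sin_acos by trivial; split; [trivial |].
  rewrite Hs; apply Rabs_right; lra.
- exists (- acos x); rewrite cos_neg, sin_neg, cos_acos, sin_acos by trivial.
  split; [trivial |]; rewrite Hs, Rabs_left; lra.
Qed.

Notation ovoid := (polar_curve depth).

Lemma ovoid_neq_0 t : ovoid t <> RtoC 0.
Proof. apply Cmod_gt_0; rewrite Cmod_polar_curve; apply exp_pos. Qed.

Lemma ovoid_cos t : Re (ovoid t) / Cmod (ovoid t) = cos t.
Proof.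
rewrite Cmod_polar_curve; simpl; field; apply Rgt_not_eq, exp_pos.
Qed.

Lemma gauge_ovoid t : gauge (ovoid t) = 0.
Proof.
unfold gauge; rewrite ovoid_cos, Cmod_polar_curve, ln_exp; unfold depth; ring.
Qed.

(** The curve is the whole zero set of the gauge, as every direction has an angle. *)
Lemma gauge_eq_0_ovoid z : z <> RtoC 0 -> gauge z = 0 -> exists t, ovoid t = z.
Proof.
intros Hz Hg; apply Cmod_gt_0 in Hz; assert (Hq := Cmod_sqr z).
destruct (polar_angle (Re z / Cmod z) (Im z / Cmod z)) as [t [Hc Hs]].
{ transitivity ((Re z ^ 2 + Im z ^ 2) / Cmod z ^ 2); [field; lra |].
  rewrite <- Hq; field; lra. }
exists t; unfold polar_curve, depth; rewrite Hc, Hs.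
replace (- / weight (Re z / Cmod z)) with (ln (Cmod z)) by (unfold gauge in Hg; lra).
rewrite exp_ln by trivial; destruct z as [x y]; cbn [Re Im fst snd] in *.
f_equal; field; lra.
Qed.

Lemma ovoid_not_star_domain t : ~ star_domain (ovoid t).
Proof.
intros [H | H]; [now apply ovoid_neq_0 in H | rewrite gauge_ovoid in H; lra].
Qed.

(** The domain and the open set where the gauge is positive cover all but the
    zero set of the gauge, hence the boundary lies on the curve.  Conversely
    shrinking a point of the curve moves it into the domain. *)
Lemma boundary_star_domain z : boundary star_domain z <-> exists t, ovoid t = z.
Proof.
split.
- intros Hb.
  assert (Hz : z <> RtoC 0).
  { intros ->.
    destruct (Hb (fun w => Cmod w < exp (- 5))) as [_ [w [Hw HV]]].
    - apply small_disk_open.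
    - rewrite Cmod_0; apply exp_pos.
    - now apply HV, small_disk_star_domain. }
  apply gauge_eq_0_ovoid; [trivial |].
  destruct (Rtotal_order (gauge z) 0) as [H | [H | H]]; [| trivial |].
  + destruct (Hb star_domain) as [_ [w [Hw HV]]];
      [exact star_domain_open | now right | easy].
  + destruct (Hb _ star_domain_exterior_open (conj Hz H)) as [[w [[Hw0 Hw] HV]] _].
    destruct HV; [easy | lra].
- intros [t <-] U oU HU; split; [| exists (ovoid t); split; trivial; apply ovoid_not_star_domain].
  replace (ovoid t) with (RtoC 1 * ovoid t)%C in HU by ring.
  destruct (open_ray U _ _ oU HU) as [d Hd].
  assert (dpos := cond_pos d).
  set (s := Rmax (/ 2) (1 - d / 2)).
  assert (Hs : / 2 <= s /\ 1 - d / 2 <= s) by (split; [apply Rmax_l | apply Rmax_r]).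
  assert (Hs1 : s < 1) by (apply Rmax_lub_lt; lra).
  exists (RtoC s * ovoid t)%C; split.
  + apply Hd; rewrite Rabs_left1; lra.
  + right; rewrite gauge_scale, gauge_ovoid by (try apply ovoid_neq_0; lra).
    assert (ln s < 0) by (rewrite <- ln_1; apply ln_increasing; lra).
    lra.
Qed.

Lemma increasing_through_0 (f : R -> R) (l : R) :
  is_derive f 0 l -> 0 < l -> f 0 = 0 ->
  exists d, 0 < d /\ forall s, 0 < s < d -> 0 < f s /\ f (- s) < 0.
Proof.
intros Hf Hl Hf0; apply is_derive_Reals in Hf.
destruct (Hf l Hl) as [d Hd]; exists d; split; [apply cond_pos |].
intros s Hs.
assert (Hq : forall h, h <> 0 -> Rabs h < d -> 0 < f h / h).
{ intros h Hh0 Hh; specialize (Hd h Hh0 Hh).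
  rewrite Rplus_0_l, Hf0, Rminus_0_r in Hd; apply Rabs_def2 in Hd; lra. }
split.
- replace (f s) with (f s / s * s) by (field; lra).
  apply Rmult_lt_0_compat; [apply Hq; [| rewrite Rabs_right]; lra | lra].
- assert (H : 0 < f (- s) / - s)
    by (apply Hq; [| rewrite Rabs_left]; lra).
  replace (f (- s)) with (- (f (- s) / - s * s)) by (field; lra).
  apply Ropp_lt_gt_0_contravar, Rmult_lt_0_compat; lra.
Qed.

(** The first summand is the derivative of [ln |z|].  The second follows from the
    derivative of the cosine [x / r] along [v], which is
    [y * (y * Re v - x * Im v) / r ^ 3] at [z = (x, y)]. *)
Lemma gauge_is_derive (z v : C) :
  z <> RtoC 0 ->
  is_derive (fun s : R => gauge (z + RtoC s * v)%C) 0
    ((Re z * Re v + Im z * Im v) / Cmod z ^ 2 +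
     9 / 10 / weight (Re z / Cmod z) ^ 2 *
       (Im z * (Im z * Re v - Re z * Im v) / Cmod z ^ 3)).
Proof.
intros Hz.
assert (Hm := proj1 (Cmod_gt_0 z) Hz).
assert (Hq := Cmod_sqr z).
assert (Hw := weight_bounds _ (Re_div_Cmod_bounds z)).
assert (Hd := Cmod_is_derive z v Hz).
apply (is_derive_ext
  (fun s => ln (Cmod (z + RtoC s * v)%C) +
     / weight ((Re z + s * Re v) / Cmod (z + RtoC s * v)%C))).
{ intros s; unfold gauge; do 4 f_equal; simpl; unfold Re; ring. }
set (m := fun s : R => Cmod (z + RtoC s * v)%C) in *.
assert (m0 : m 0 = Cmod z) by (unfold m; f_equal; ring).
unfold weight in *.
assert (em : ex_derive m 0) by (eexists; exact Hd).
assert (dm : Derive (fun x => m x) 0 = (Re z * Re v + Im z * Im v) / Cmod z)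
  by now apply is_derive_unique.
change (is_derive (fun s => ln (m s) + / (11 / 10 + - (9 / 10) * ((Re z + s * Re v) / m s))) 0
  ((Re z * Re v + Im z * Im v) / Cmod z ^ 2 +
     9 / 10 / (11 / 10 + - (9 / 10) * (Re z / Cmod z)) ^ 2 *
       (Im z * (Im z * Re v - Re z * Im v) / Cmod z ^ 3))).
auto_derive.
- rewrite m0, Rmult_0_l, Rplus_0_r; unfold Rdiv in *; repeat split; trivial; lra.
- rewrite m0, dm, !Rmult_0_l, !Rplus_0_r.
  (* Eliminating [Im z ^ 2] leaves an identity in which [Cmod z] is a free variable. *)
  replace (Im z * (Im z * Re v - Re z * Im v)) with
    (Re v * Cmod z ^ 2 - Re z * (Re z * Re v + Im z * Im v)) by (rewrite Hq; ring).
  unfold Rdiv in *.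
  set (w := 11 * / 10 + - (9 * / 10) * (Re z * / Cmod z)) in *.
  field; lra.
Qed.

Lemma depth_is_derive t : is_derive depth t (- (9 / 10) * sin t / weight (cos t) ^ 2).
Proof.
assert (H := weight_bounds _ (COS_bound t)).
unfold depth, weight in *; auto_derive; [lra | field; lra].
Qed.

(** * Smoothness, normal and total curvature *)

Lemma depth_bounds t : / 2 <= depth t <= 5.
Proof. apply inv_weight_bounds, COS_bound. Qed.

Lemma depth_elementary : elementary depth.
Proof.
apply elementary_inv.
- apply (elementary_plus (fun _ => 11 / 10) (fun t => - (9 / 10) * cos t)); [constructor |].
  apply (elementary_mult (fun _ => - (9 / 10)) cos); constructor.
- intros t; assert (H := weight_bounds _ (COS_bound t)); lra.
Qed.

Lemma cos_sin_inj s t :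
  0 <= s < 2 * PI -> 0 <= t < 2 * PI -> cos s = cos t -> sin s = sin t -> s = t.
Proof.
intros Hs Ht Hc Hsin.
assert (H : sin ((s - t) / 2) = 0).
{ assert (Hcd : cos (2 * ((s - t) / 2)) = 1).
  { replace (2 * ((s - t) / 2)) with (s - t) by field.
    rewrite cos_minus, Hc, Hsin, <- (cos_sin_sqr t); ring. }
  rewrite cos_2a_sin in Hcd; nra. }
destruct (Rtotal_order s t) as [Hlt | [? | Hgt]]; trivial.
- assert (0 < sin (- ((s - t) / 2))) by (apply sin_gt_0; lra).
  rewrite sin_neg in *; lra.
- assert (0 < sin ((s - t) / 2)) by (apply sin_gt_0; lra); lra.
Qed.

Lemma ovoid_simple_closed_smooth : simple_closed_smooth_curve ovoid (2 * PI).
Proof.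
assert (HPI := PI_RGT_0).
assert (Er : elementary (fun t => exp (- depth t))).
{ apply elementary_exp, elementary_opp, depth_elementary. }
destruct (elementary_is_derive _ depth_elementary) as [L1 [_ H1]].
repeat split.
- lra.
- intros k m t; apply elementary_ex_derive_n; destruct k;
    apply (elementary_mult (fun t => exp (- depth t))); trivial; constructor.
- apply (velocity_polar_curve_neq_0 _ _ H1).
- intros t; unfold polar_curve, depth.
  now rewrite cos_plus, sin_plus, cos_2PI, sin_2PI, !Rmult_0_r, !Rmult_1_r, Rminus_0_r, Rplus_0_r.
- intros s t Hs Ht Hst.
  assert (Hr : exp (- depth s) = exp (- depth t)) by now rewrite <- !Cmod_polar_curve, Hst.
  assert (He := exp_pos (- depth t)).
  injection Hst; rewrite Hr; intros Hsin Hcos.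
  apply Rmult_eq_reg_l in Hsin, Hcos; try lra.
  now apply cos_sin_inj.
Qed.

(** The gauge increases along the normal at rate [(1 + L' ^ 2) / |velocity|].
    Since the domain contains 0 whatever the gauge is there, a segment along the
    outward normal must also be too short to reach 0: the normal has length 1 and
    the distance to 0 is [exp (- depth t)]. *)
Lemma ovoid_outward_normal t :
  outward_normal hyp_pdisk star_domain ovoid t (right_normal ovoid t).
Proof.
destruct (elementary_is_derive _ depth_elementary) as [L1 [_ H1]].
assert (E1 : L1 t = - (9 / 10) * sin t / weight (cos t) ^ 2)
  by (rewrite <- (is_derive_unique _ _ _ (H1 t)); apply is_derive_unique, depth_is_derive).
assert (Hv := velocity_polar_curve_neq_0 _ _ H1 t).
assert (Hn := Cmod_right_normal _ _ Hv).
assert (Hr := Cmod_polar_curve depth t).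
assert (Hr0 := exp_pos (- depth t)).
assert (Hm := proj1 (Cmod_gt_0 _) Hv).
split; [| split].
- intros H0; rewrite H0, Cmod_0 in Hn; lra.
- unfold hyp_pdisk; rewrite conformal_inner; unfold right_normal; cbn [Re Im fst snd].
  unfold Re, Im; field; lra.
- destruct (increasing_through_0 (fun s => gauge (ovoid t + RtoC s * right_normal ovoid t)%C)
    ((1 + L1 t ^ 2) / Cmod (velocity ovoid t))) as [d [Hd0 Hd]].
  + evar_last; [apply gauge_is_derive, ovoid_neq_0 |].
    rewrite ovoid_cos, Hr; unfold right_normal; cbv zeta.
    set (m := Cmod (velocity ovoid t)) in *.
    rewrite (velocity_polar_curve _ _ H1); unfold polar_curve; cbn [Re Im fst snd].
    set (r := exp (- depth t)) in *.
    transitivity ((cos t ^ 2 + sin t ^ 2) * (1 +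
      - (9 / 10) * sin t / weight (cos t) ^ 2 * L1 t) / m).
    * assert (H := weight_bounds _ (COS_bound t)); field; lra.
    * rewrite cos_sin_sqr, <- E1; field; lra.
  + apply Rdiv_lt_0_compat; [nra | trivial].
  + replace (ovoid t + RtoC 0 * _)%C with (ovoid t) by ring; apply gauge_ovoid.
  + exists (Rmin d (exp (- depth t))); split; [now apply Rmin_glb_lt |].
    intros s Hs.
    assert (Hsd := Rmin_l d (exp (- depth t))); assert (Hsr := Rmin_r d (exp (- depth t))).
    destruct (Hd s ltac:(lra)) as [Hout Hin].
    split.
    * intros [H0 | Hneg]; [| simpl in *; lra].
      assert (Hs' : Cmod (RtoC s * right_normal ovoid t)%C = Cmod (ovoid t)).
      { rewrite <- (Cmod_opp (ovoid t)); f_equal.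
        transitivity (ovoid t + RtoC s * right_normal ovoid t - ovoid t)%C; [ring |].
        rewrite H0; ring. }
      rewrite Cmod_mult, Hn, Cmod_R, Rabs_right, Hr in Hs' by lra; lra.
    * right; replace (ovoid t - _)%C with (ovoid t + RtoC (- s) * right_normal ovoid t)%C
        by (rewrite RtoC_opp; ring); trivial.
Qed.

(** [2 * PI] times the mean of [weight (cos t)]; the part [atan (L1 t)] of the
    primitive is periodic. *)
Lemma ovoid_total_curvature :
  is_RInt (fun t => geodesic_curvature hyp_pdisk ovoid (right_normal ovoid) t *
                    speed hyp_pdisk ovoid t) 0 (2 * PI) (11 / 10 * (2 * PI)).
Proof.
destruct (elementary_is_derive _ depth_elementary) as [L1 [El1 H1]].
destruct (elementary_is_derive _ El1) as [L2 [El2 H2]].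
destruct (elementary_is_derive _ El2) as [L3 [_ H3]].
assert (E1 : forall t, L1 t = - (9 / 10) * sin t / weight (cos t) ^ 2)
  by (intros t; rewrite <- (is_derive_unique _ _ _ (H1 t));
      apply is_derive_unique, depth_is_derive).
set (F := fun t => 11 / 10 * t - 9 / 10 * sin t + atan (L1 t)).
apply (is_RInt_ext (fun t => weight (cos t) + L2 t / (1 + L1 t ^ 2))).
{ intros t _; rewrite (polar_curve_curvature_form depth L1 L2) by
    (trivial; assert (H := depth_bounds t); lra).
  unfold depth; now rewrite Rinv_inv. }
replace (11 / 10 * (2 * PI)) with (F (2 * PI) - F 0).
2:{ unfold F; rewrite !E1, sin_2PI, sin_0; unfold Rdiv; rewrite !Rmult_0_r, !Rmult_0_l; ring. }
apply (is_RInt_derive F).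
- intros t _; unfold F.
  evar_last.
  + apply (is_derive_plus (fun t => 11 / 10 * t - 9 / 10 * sin t) (fun t => atan (L1 t))).
    * auto_derive; [trivial | reflexivity].
    * apply (is_derive_comp atan L1); [apply is_derive_atan | apply H2].
  + unfold plus, scal, weight; simpl; unfold mult; simpl; rewrite Rsqr_pow2; field; nra.
- intros t _.
  apply (ex_derive_continuous (fun t => weight (cos t) + L2 t / (1 + L1 t ^ 2))).
  unfold weight; auto_derive; repeat split; [now exists (L3 t) | now exists (L2 t) | nra].
Qed.

(** * The maximum of lambda on the curve *)

(** With [v = 5 - / w] this reads [5 <= (5 - v) * exp v] for [0 <= v <= 9 / 2].
    The minorant [(1 + v / 2) ^ 2] of [exp v] suffices, since
    [(5 - v) * (1 + v / 2) ^ 2 - 5 = v * (16 + v - v ^ 2) / 4]. *)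
Lemma exp_inv_le w : / 5 <= w <= 2 -> w * exp (/ w) <= exp 5 / 5.
Proof.
intros Hw; set (v := 5 - / w).
assert (Hwi : w * / w = 1) by (field; lra).
assert (Hv : 0 <= v <= 9 / 2).
{ unfold v; split.
  - assert (/ w <= 5) by (rewrite <- (Rinv_inv 5); apply Rinv_le_contravar; lra); lra.
  - assert (/ 2 <= / w) by (apply Rinv_le_contravar; lra); lra. }
assert (He : (1 + v / 2) ^ 2 <= exp v).
{ replace v with (v / 2 + v / 2) at 2 by field; rewrite exp_plus.
  assert (1 + v / 2 <= exp (v / 2)) by apply exp_ineq1_le; nra. }
replace 5 with (/ w + v) at 1 by (unfold v; ring); rewrite exp_plus.
assert (Hp := exp_pos (/ w)).
enough (5 * w <= exp v) by nra.
apply Rle_trans with (2 := He).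
assert (Hwv : w * (5 - v) = 1) by (unfold v; lra).
assert (0 <= v * (16 + v - v ^ 2)) by (apply Rmult_le_pos; nra).
assert (5 <= (1 + v / 2) ^ 2 * (5 - v)) by nra.
replace ((1 + v / 2) ^ 2) with (w * ((1 + v / 2) ^ 2 * (5 - v)))
  by (rewrite <- (Rmult_1_r ((1 + v / 2) ^ 2)) at 2; rewrite <- Hwv; ring).
nra.
Qed.

Lemma depth_0 : depth 0 = 5.
Proof. unfold depth, weight; rewrite cos_0; field. Qed.

Lemma lambda_ovoid_max t : lambda_pdisk (ovoid t) <= lambda_pdisk (ovoid 0).
Proof.
assert (H := depth_bounds t).
rewrite !lambda_polar_curve by (try rewrite depth_0; lra).
rewrite depth_0; unfold depth, Rdiv; rewrite Rinv_inv, Rmult_comm.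
apply exp_inv_le, weight_bounds, COS_bound.
Qed.

(** At [t = 0] the angular derivative of [depth] vanishes, so the normal is radial,
    and the logarithmic derivative of lambda along it is
    [- (1 + / ln |z|) / |z| = - 4 / (5 * |z|)]. *)
Lemma lambda_ovoid_normal_derivative :
  dirderiv lambda_pdisk (ovoid 0) (right_normal ovoid 0) < 0.
Proof.
assert (Hd := depth_is_derive 0).
assert (Hr0 := exp_pos (- depth 0)).
unfold dirderiv; erewrite is_derive_unique;
  [| apply lambda_pdisk_is_derive, polar_curve_punctured_disk; rewrite depth_0; lra].
rewrite Cmod_polar_curve, ln_exp, depth_0, lambda_polar_curve by (rewrite depth_0; lra).
destruct (elementary_is_derive _ depth_elementary) as [L1 [_ H1]].
assert (E1 : L1 0 = 0).
{ rewrite <- (is_derive_unique _ _ _ (H1 0)), (is_derive_unique _ _ _ Hd), sin_0.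
  unfold Rdiv; ring. }
assert (Hm := proj1 (Cmod_gt_0 _) (velocity_polar_curve_neq_0 _ _ H1 0)).
unfold right_normal; cbv zeta; set (m := Cmod (velocity ovoid 0)) in *.
rewrite (velocity_polar_curve _ _ H1), E1; unfold polar_curve; cbn [Re Im fst snd].
rewrite depth_0 in *; rewrite cos_0, sin_0.
apply Rlt_gt, Ropp_lt_cancel; rewrite Ropp_0.
assert (H5 := exp_pos 5).
replace (- _) with (exp 5 * / 5 * (4 / 5) * / m); [| field; lra].
assert (0 < / m) by now apply Rinv_0_lt_compat.
apply Rmult_lt_0_compat; lra.
Qed.

Theorem theorem2p9p2 :
  exists (gamma : R -> C) (T : R) (V : C -> Prop) (n : R -> C),
    simple_closed_smooth_curve gamma T /\
    (forall t, punctured_disk (gamma t)) /\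
    plane_domain V /\
    (forall z, V z -> unit_disk z) /\
    V (RtoC 0) /\
    (forall z, boundary V z <-> exists t, gamma t = z) /\
    (forall t, outward_normal hyp_pdisk V gamma t (n t) /\ Cmod (n t) = 1) /\
    (exists K : R,
       is_RInt (fun t => geodesic_curvature hyp_pdisk gamma n t * speed hyp_pdisk gamma t)
         0 T K /\
       2 * PI < K) /\
    (exists tmax : R,
       (forall t, lambda_pdisk (gamma t) <= lambda_pdisk (gamma tmax)) /\
       dirderiv lambda_pdisk (gamma tmax) (n tmax) < 0).
Proof.
exists ovoid, (2 * PI), star_domain, (right_normal ovoid).
split; [exact ovoid_simple_closed_smooth |].
split; [intros t; apply polar_curve_punctured_disk; assert (H := depth_bounds t); lra |].
split; [exact star_domain_plane_domain |].
split; [exact star_domain_unit_disk |].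
split; [now left |].
split; [exact boundary_star_domain |].
split.
- intros t; split; [apply ovoid_outward_normal |].
  destruct (elementary_is_derive _ depth_elementary) as [L1 [_ H1]].
  apply Cmod_right_normal, (velocity_polar_curve_neq_0 _ _ H1).
- split.
  + exists (11 / 10 * (2 * PI)); split; [exact ovoid_total_curvature |].
    assert (HPI := PI_RGT_0); lra.
  + exists 0; split; [exact lambda_ovoid_max | exact lambda_ovoid_normal_derivative].
Qed.
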